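(* Let $m\ge 2$ be an integer and $e=(3^h+1)/2$, where $1\le h\le m-1$. Then the ternary cyclic code $\mathcal{C}_{(1,e)}$ has parameters $[3^m-1,\,3^m-1-2m,\,4]$ if and only if $h$ is odd and $\gcd(m,h)=1$, i.e., if and only if $x^e$ is planar over $\mathrm{GF}(3^m)$.
   Context: Let $q=3^m$, $n=q-1$, $\alpha$ a generator of $\mathrm{GF}(q)^*$, and $m_a(x)$ the minimal polynomial of $a\in\mathrm{GF}(q)$ over $\mathrm{GF}(3)$. $C_j$ denotes the $3$-cyclotomic coset modulo $n$ containing $j$, i.e. $\{j,3j,3^2j,\dots\}$ mod $n$. For $1<e<q-1$ with $e\notin C_1$, $\mathcal{C}_{(1,e)}$ is the cyclic code of length $n$ over $\mathrm{GF}(3)$ with generator polynomial $m_\alpha(x)m_{\alpha^e}(x)$. A function $f$ on $\mathrm{GF}(q)$ is planar if for every $a\in\mathrm{GF}(q)^*$ and $b\in\mathrm{GF}(q)$ the equation $f(x+a)-f(x)=b$ has at most one solution $x\in\mathrm{GF}(q)$. *)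

(* Defs.v *)
From mathcomp Require Import all_boot all_order all_algebra all_field.
Set Implicit Arguments.
Unset Strict Implicit.
Unset Printing Implicit Defensive.
Import GRing.Theory.
Local Open Scope ring_scope.

Definition F3toF (F : finFieldType) (x : 'F_3) : F := (val x)%:R.

Definition is_minpoly3 (F : finFieldType) (a : F) (p : {poly 'F_3}) : Prop :=
  [/\ p \is monic, root (map_poly (@F3toF F) p) a &
      forall q : {poly 'F_3}, q != 0 -> root (map_poly (@F3toF F) q) a ->
        (size p <= size q)%N].

Definition wpoly (n : nat) (c : 'rV['F_3]_n) : {poly 'F_3} :=
  \sum_(i < n) c 0 i *: 'X^i.

(* The cyclic code of length n over GF(3) with generator polynomial g
   (g a divisor of x^n - 1): the words whose polynomial is a multiple of g. *)
Definition cyclic_code (n : nat) (g : {poly 'F_3}) : {set 'rV['F_3]_n} :=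
  [set c | g %| wpoly c].

Definition wt (n : nat) (c : 'rV['F_3]_n) : nat := #|[set i | c 0 i != 0]|.

Definition has_dim_dist (n : nat) (C : {set 'rV['F_3]_n}) (k d : nat) : Prop :=
  [/\ #|C| = (3 ^ k)%N,
      exists2 c, c \in C & (c != 0) && (wt c == d) &
      forall c, c \in C -> c != 0 -> (d <= wt c)%N].

Definition planar (F : finFieldType) (f : F -> F) : Prop :=
  forall a b : F, a != 0 -> let S := [set x : F | f (x + a) - f x == b] in (#|S| <= 1)%N.

(* Main.v *)
From HB Require Import structures.
Require Import Defs.
From mathcomp Require Import all_boot all_order all_algebra all_field ring zify.
Import GRing.Theory.
Local Open Scope ring_scope.

(* Write f(x) = x^e with e = (3^h + 1)/2 and k = (3^h - 1)/2. In an algebraic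
   closure put x - 1 = (w + 1/w)^2; then x + 1 = (w - 1/w)^2, x = y + 1/y with
   y = w^2, and f(x + 1) - f(x - 1) = y^k + y^-k. If h is odd and gcd(m, h) = 1,
   then k is coprime to 3^(2m) - 1, so y^k determines y and f is planar.
   If f is planar, then e is even, and planarity at (x, x + a) excludes codewords
   of weight at most 3; solving f(x + a) - f(x) = 1 + f(alpha) with
   a = 1 + alpha produces one of weight 4.
   Conversely, for even h (odd e) the points 1, -1 carry a codeword of weight 2,
   and for odd h with gcd(m, h) > 1 a fixed point u of x -> x^(3^h) outside GF(3)
   gives a codeword of weight 3 supported on +-u, 1, +-(u + 1). *)

(** * Fixed points of power maps and the exponents (3^h + 1)/2 and (3^h - 1)/2 *)

Lemma expr_pow_fixed (R : nzRingType) (t : R) (p a u : nat) :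
  t ^+ (p ^ a) = t -> t ^+ (p ^ (a * u)) = t.
Proof.
by move=> ta; elim: u => [|u IH]; rewrite ?muln0 // mulnS expnD exprM ta.
Qed.

(** Bezout: with [u * a = v * b + 1], t = t^(p^(u a)) = (t^(p^(v b)))^p = t^p. *)
Lemma expr_fixed_coprime (R : nzRingType) (t : R) (p a b : nat) :
  (0 < a)%N -> coprime a b ->
  t ^+ (p ^ a) = t -> t ^+ (p ^ b) = t -> t ^+ p = t.
Proof.
move=> a0 cop ta tb; case: (egcdnP b a0) => u v E _.
move: cop; rewrite /coprime => /eqP g1.
have := expr_pow_fixed R t p a u ta.
by rewrite mulnC E g1 addn1 mulnC expnSr exprM expr_pow_fixed.
Qed.

Lemma half_expn3 (h : nat) : ((3 ^ h + 1) %/ 2).*2 = (3 ^ h + 1)%N.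
Proof. by rewrite -muln2 divnK // dvdn2 oddD oddX orbT. Qed.

Lemma half_expn3_pred (h : nat) : ((3 ^ h - 1) %/ 2).*2 = (3 ^ h - 1)%N.
Proof. by rewrite -muln2 divnK // dvdn2 oddB ?expn_gt0 // oddX orbT. Qed.

(** The residue modulo 4 decides the parities of (3^h + 1)/2 and (3^h - 1)/2. *)
Lemma expn3_mod4 (h : nat) : (3 ^ h %% 4 = if odd h then 3 else 1)%N.
Proof. by elim: h => // h IH; rewrite expnS -modnMmr IH /=; case: odd. Qed.

Lemma odd_half_expn3 (h : nat) : odd ((3 ^ h + 1) %/ 2) = ~~ odd h.
Proof.
have := half_expn3 h; have := expn3_mod4 h.
set e := (_ %/ 2)%N; case: (odd h) => /=; lia.
Qed.

Lemma odd_half_expn3_pred (h : nat) : odd ((3 ^ h - 1) %/ 2) = odd h.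
Proof.
have := half_expn3_pred h; have := expn3_mod4 h; have : (0 < 3 ^ h)%N by rewrite expn_gt0.
set e := (_ %/ 2)%N; case: (odd h) => /=; lia.
Qed.

Lemma exprD_pow3 (R : comNzRingType) (x y : R) (h : nat) :
  3%N \in [pchar R] -> (x + y) ^+ (3 ^ h) = x ^+ (3 ^ h) + y ^+ (3 ^ h).
Proof. by move=> c3; apply: exprDn_pchar; rewrite pnatX pnatE ?c3. Qed.

Lemma exprN_pow3 (R : nzRingType) (x : R) (h : nat) :
  (- x) ^+ (3 ^ h) = - x ^+ (3 ^ h).
Proof. by rewrite exprNn -signr_odd oddX orbT /= expr1 mulN1r. Qed.

Lemma natr3_pchar (R : comNzRingType) : 3%N \in [pchar R] -> 3%:R = 0 :> R.
Proof. by move/pcharf0. Qed.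

(** * Planarity of x^e through the substitution x = y + 1/y *)

Lemma Zhukovsky_square (L : closedFieldType) (x : L) :
  3%N \in [pchar L] ->
  exists w : L, [/\ w != 0, x - 1 = (w + w^-1) ^+ 2,
    x + 1 = (w - w^-1) ^+ 2 & x = w ^+ 2 + (w ^+ 2)^-1].
Proof.
move/natr3_pchar => c3.
(* [s] is a square root of x - 1 and [w] a root of w^2 - s w + 1, so that w + 1/w = s; the other two
   identities then follow from 3 = 0. *)
have [s Hs] := @solve_monicpoly L 2 (fun i => if i == 0%N then x - 1 else 0) isT.
have [w Hw] := @solve_monicpoly L 2 (fun i => if i == 0%N then -1 else s) isT.
move: Hs Hw; rewrite !big_ord_recl !big_ord0 /= /bump /= !addn0.
rewrite !expr0 !expr1 !mulr1 !mul0r !addr0 => Hs Hw.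
have w0 : w != 0.
  by apply/eqP => w0; move/eqP: Hw; rewrite w0 expr0n mulr0 addr0 eq_sym oppr_eq0 oner_eq0.
have E : s = w + w^-1.
  apply: (mulIf w0); rewrite mulrDl mulVf // -expr2 Hw; ring.
have ww : w * w^-1 = 1 by rewrite divff.
have A : x - 1 = (w + w^-1) ^+ 2 by rewrite -E Hs.
have B : (w - w^-1) ^+ 2 = (w + w^-1) ^+ 2 - 4%:R * (w * w^-1) by ring.
have C : (w ^+ 2 + (w ^+ 2)^-1) = (w + w^-1) ^+ 2 - 2%:R * (w * w^-1).
  by rewrite -exprVn; ring.
exists w; split=> //.
- rewrite B -A ww mulr1 -[LHS]subr0 -(mul0r 2%:R) -c3; ring.
- rewrite C -A ww mulr1 -[LHS]subr0 -c3; ring.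
Qed.

(* With x = y + y^-1 and y = w^2, the right-hand side is the Dickson polynomial
   of degree (3^h - 1)/2 at x. *)
Lemma half_power_difference (L : fieldType) (w : L) (h : nat) :
  3%N \in [pchar L] -> w != 0 ->
  let k := ((3 ^ h - 1) %/ 2)%N in
  let e := ((3 ^ h + 1) %/ 2)%N in
  ((w - w^-1) ^+ 2) ^+ e - ((w + w^-1) ^+ 2) ^+ e =
  (w ^+ 2) ^+ k + ((w ^+ 2) ^+ k)^-1.
Proof.
move=> c3 w0 k e; have c30 := natr3_pchar _ c3.
have H2 := half_expn3 h; have H1 := half_expn3_pred h.
rewrite -/e -/k in H1 H2; have p0 : (0 < 3 ^ h)%N by rewrite expn_gt0.
rewrite -!exprM !mul2n H2 addn1 !exprSr !exprD_pow3 // exprN_pow3 -exprVn.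
have -> : (3 ^ h = k.*2.+1)%N by lia.
rewrite !exprSr.
have wk : w ^+ k.*2 * w^-1 ^+ k.*2 = 1 by rewrite -exprMn divff ?expr1n.
have ww : w * w^-1 = 1 by rewrite divff.
set a := w ^+ _ in wk *; set b := _ ^+ k.*2 in wk *.
set v := w^-1 in ww *.
(* Only the cross terms survive the subtraction, and -2 = 1. *)
transitivity (- 2%:R * (w * v) * (a + b)); first by ring.
by rewrite ww -[RHS]subr0 -(mul0r (a + b)) -c30; ring.
Qed.

Lemma inv_sum_eq (L : fieldType) (y z : L) :
  y != 0 -> z != 0 -> y + y^-1 = z + z^-1 -> y = z \/ y = z^-1.
Proof.
move=> y0 z0 E.
have : (y - z) * (y - z^-1) = 0.
  have -> : (y - z) * (y - z^-1) = (y + y^-1 - (z + z^-1)) * y + z * z^-1 - y * y^-1 by ring.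
  by rewrite E subrr mul0r add0r !divff ?subrr.
by move/eqP; rewrite mulf_eq0 !subr_eq0 => /orP[]/eqP; [left | right].
Qed.

(** The elements y^(3^m) and y have the same sum with their inverses, so y^(3^m) is y or 1/y; a
    second application restores y in both cases. *)
Lemma fixed_inv_sum (L : fieldType) (y : L) (m : nat) :
  3%N \in [pchar L] -> y != 0 ->
  (y + y^-1) ^+ (3 ^ m) = y + y^-1 -> y ^+ (3 ^ (m * 2)) = y.
Proof.
move=> c3 y0; rewrite exprD_pow3 // exprVn => /inv_sum_eq E.
have [] := E _ y0; first by rewrite expf_neq0.
  by move=> Ey; rewrite expr_pow_fixed.
by move=> Ey; rewrite muln2 -addnn expnD exprM Ey exprVn Ey invrK.
Qed.

(** The quotient t = y/z has t^k = 1, hence t^(3^h) = t. As h is odd, it is coprime to 2m as well as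
    to m, so t^3 = t and t^2 = 1; the oddness of k then leaves t = 1. *)
Lemma half_pow_inj (L : fieldType) (y z : L) (m h : nat) :
  odd h -> coprime m h -> y != 0 -> z != 0 ->
  y ^+ (3 ^ (m * 2)) = y -> z ^+ (3 ^ (m * 2)) = z ->
  y ^+ ((3 ^ h - 1) %/ 2) = z ^+ ((3 ^ h - 1) %/ 2) -> y = z.
Proof.
move=> oh cop y0 z0 Hy Hz; set k := (_ %/ 2)%N => E.
have H1 := half_expn3_pred h; have ok := odd_half_expn3_pred h.
rewrite -/k oh in H1 ok; have p0 : (0 < 3 ^ h)%N by rewrite expn_gt0.
pose t := y / z.
have t0 : t != 0 by rewrite mulf_neq0 ?invr_neq0.
have tk : t ^+ k = 1 by rewrite expr_div_n E divff ?expf_neq0.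
have tm : t ^+ (3 ^ (m * 2)) = t by rewrite expr_div_n Hy Hz.
have th : t ^+ (3 ^ h) = t.
  have -> : (3 ^ h = (k * 2).+1)%N by lia.
  by rewrite exprS exprM tk expr1n mulr1.
have h0 : (0 < h)%N by case: h oh {cop E H1 ok th p0 tk} @k.
have t3 : t ^+ 3 = t.
  apply: (expr_fixed_coprime _ t 3 h (m * 2)) => //.
  by rewrite coprime_sym coprimeMl cop coprime2n.
have t2 : t ^+ 2 = 1 by apply: (mulfI t0); rewrite -exprS t3 mulr1.
have t1 : t = 1.
  rewrite -tk -[X in _ ^+ X]odd_double_half ok exprD -mul2n exprM t2.
  by rewrite expr1n mulr1 expr1.
by apply: (mulIf (invr_neq0 z0)); rewrite divff.
Qed.

(** Writing x = y + 1/y and x' = z + 1/z in the closure, the hypothesis gives y^k = z^k or y^k =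
    z^-k, hence y = z or y = 1/z, and both give x = x'. *)
Lemma half_power_diff_inj (F : finFieldType) (m h : nat) (x x' : F) :
  #|F| = (3 ^ m)%N -> odd h -> coprime m h ->
  let e := ((3 ^ h + 1) %/ 2)%N in
  (x + 1) ^+ e - (x - 1) ^+ e = (x' + 1) ^+ e - (x' - 1) ^+ e -> x = x'.
Proof.
move=> cF oh cop e E.
have c3 := card_finPcharP cF isT.
have [L [f _]] := countable_algebraic_closure F.
have cL : 3%N \in [pchar L] by rewrite (fmorph_pchar f).
apply: (fmorph_inj f).
have [w [w0 w1 w2 w3]] := Zhukovsky_square L (f x) cL.
have [v [v0 v1 v2 v3]] := Zhukovsky_square L (f x') cL.
have fixf (a : F) : f a ^+ (3 ^ m) = f a by rewrite -rmorphXn -cF expf_card.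
have W0 : w ^+ 2 != 0 by rewrite expf_neq0.
have V0 : v ^+ 2 != 0 by rewrite expf_neq0.
have Hw : (w ^+ 2) ^+ (3 ^ (m * 2)) = w ^+ 2.
  by apply: fixed_inv_sum; rewrite // -w3 fixf.
have Hv : (v ^+ 2) ^+ (3 ^ (m * 2)) = v ^+ 2.
  by apply: fixed_inv_sum; rewrite // -v3 fixf.
have := congr1 f E.
rewrite !rmorphB !rmorphXn !rmorphD !rmorphN !rmorph1 w1 w2 v1 v2.
rewrite !half_power_difference // => /inv_sum_eq Ek.
rewrite w3 v3.
have [] := Ek (expf_neq0 _ W0) (expf_neq0 _ V0).
  by move/(half_pow_inj L _ _ m h oh cop W0 V0 Hw Hv) => ->.
rewrite -exprVn => /(half_pow_inj L _ _ m h oh cop W0 (invr_neq0 V0) Hw) ->.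
  by rewrite invrK addrC.
by rewrite exprVn Hv.
Qed.

Lemma planarP (F : finFieldType) (f : F -> F) :
  planar f <->
  forall a x y : F, a != 0 -> f (x + a) - f x = f (y + a) - f y -> x = y.
Proof.
split=> [pf a x y a0 E | inj a b a0 /=].
  by apply: (card_le1_eqP (pf a (f (y + a) - f y) a0)); rewrite inE ?E.
by apply/card_le1_eqP => x y; rewrite !inE => /eqP Ex /eqP Ey; apply: (inj a); rewrite ?Ex.
Qed.

Lemma half_power_planar (F : finFieldType) (m h : nat) :
  #|F| = (3 ^ m)%N -> odd h -> coprime m h ->
  planar (fun x : F => x ^+ ((3 ^ h + 1) %/ 2)).
Proof.
move=> cF oh cop; apply/planarP => a x y a0; set e := (_ %/ 2)%N => E.
have c3 := natr3_pchar _ (card_finPcharP cF isT).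
have na0 : - a != 0 by rewrite oppr_eq0.
(* Since 3 = 0, this affine change turns the pair x, x + a into -a (X - 1), -a (X + 1); the factor
   (-a)^e then cancels. *)
pose X (x : F) := x / - a + 1.
have EX x0 : x0 = - a * (X x0 - 1) by rewrite /X addrK mulrC divfK.
have EXa x0 : x0 + a = - a * (X x0 + 1).
  by rewrite {1}[x0]EX -[LHS]subr0 -(mul0r a) -c3; ring.
suff EXY : X x = X y by rewrite [x]EX EXY -EX.
apply: (half_power_diff_inj F m h) => //; rewrite -/e.
apply: (mulfI (expf_neq0 e na0)).
by rewrite !mulrBr -!exprMn -!EX -!EXa.
Qed.

(** * Consequences of planarity *)

Lemma exprN_even (R : nzRingType) (x : R) (e : nat) : ~~ odd e -> (- x) ^+ e = x ^+ e.
Proof. by move=> ee; rewrite exprNn -signr_odd (negbTE ee) mul1r. Qed.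

Lemma planar_power_even (F : finFieldType) (e : nat) :
  2%:R != 0 :> F -> planar (fun x : F => x ^+ e) -> ~~ odd e.
Proof.
move=> two0 /planarP inj; apply/negP => oe.
have No (x : F) : (- x) ^+ e = - x ^+ e by rewrite exprNn -signr_odd oe expr1 mulN1r.
have E : (0 : F) = - 1.
  (* For odd e the increments 1^e - 0^e and 0^e - (-1)^e are both 1. *)
  apply: (inj 1); rewrite ?oner_eq0 // addNr add0r No expr0n.
  by case: e oe {inj No} => //= e _; rewrite expr1n subr0 opprK add0r.
by move/eqP: E; rewrite eq_sym oppr_eq0 oner_eq0.
Qed.

(** The increments of f by the step v agree at u and at 0. *)
Lemma planar_additive_pair (F : finFieldType) (f : F -> F) (u v : F) :
  planar f -> f 0 = 0 -> f (u + v) = f u + f v -> u = 0 \/ v = 0.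
Proof.
move=> /planarP inj f0 E; case: (eqVneq v 0) => [|v0]; [by right | left].
by apply: (inj v) => //; rewrite add0r f0 subr0 E [f u + _]addrC addrK.
Qed.

(* In characteristic 3, u + v + w = 0 says that u, w, v is an arithmetic
   progression, and f u + f w + f v = 0 says the same of the images. *)
Lemma planar_zero_sum_triple (F : finFieldType) (f : F -> F) (u v w : F) :
  3%:R = 0 :> F -> planar f ->
  u + v + w = 0 -> f u + f v + f w = 0 -> u = w.
Proof.
move=> c3 /planarP inj E1 E2; apply/eqP/negPn/negP => uw.
have d0 : u - w != 0 by rewrite subr_eq0.
have Ev : v = w - (u - w).
  apply/eqP; rewrite -subr_eq0; apply/eqP.
  transitivity (u + v + w - 3%:R * w); first by ring.
  by rewrite E1 c3 mul0r subr0.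
have : w = v.
  have e1 : w + (u - w) = u by rewrite addrC subrK.
  have e2 : v + (u - w) = w by rewrite Ev subrK.
  apply: (inj (u - w)) => //; rewrite e1 e2.
  apply/eqP; rewrite -subr_eq0; apply/eqP.
  transitivity (f u + f v + f w - 3%:R * f w); first by ring.
  by rewrite E2 c3 mul0r subr0.
move=> wv; move/eqP: d0; apply.
by apply: (subrI w); rewrite -Ev subr0 -wv.
Qed.

(** With the step y - x, the increments at x and at -y are y^e - x^e and x^e - y^e, both zero. *)
Lemma planar_power_eq (F : finFieldType) (e : nat) (x y : F) :
  planar (fun x : F => x ^+ e) -> ~~ odd e -> x ^+ e = y ^+ e -> x = y \/ x = - y.
Proof.
move=> /planarP inj ee E; case: (eqVneq x y) => [|xy]; [by left | right].
have Ne z := exprN_even F z e ee.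
apply: (inj (y - x)); first by rewrite subr_eq0 eq_sym.
have e1 : x + (y - x) = y by rewrite addrC subrK.
by rewrite e1 addKr !Ne E subrr.
Qed.

(** * Minimal polynomials over GF(3) and the size of a cyclic code *)

Lemma pchar3_F3toF (F : finFieldType) :
  3%N \in [pchar F] -> exists phi : {rmorphism 'F_3 -> F}, F3toF F =1 phi.
Proof.
move=> c3.
have addF : nmod_morphism (F3toF F).
  by split=> // x y; rewrite /F3toF -natrD -[RHS](GRing.natr_mod_pchar c3).
have mulF : monoid_morphism (F3toF F).
  by split=> // x y; rewrite /F3toF -natrM -[RHS](GRing.natr_mod_pchar c3).
pose addM := GRing.isNmodMorphism.Build _ _ (F3toF F) addF.
pose mulM := GRing.isMonoidMorphism.Build _ _ (F3toF F) mulF.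
pose phi : {rmorphism 'F_3 -> F} := HB.pack (F3toF F) addM mulM.
by exists phi.
Qed.

Lemma F3_cases (c : 'F_3) : [\/ c = 0, c = 1 | c = -1].
Proof.
by case: c => [[|[|[|//]]]] i; [apply: Or31 | apply: Or32 | apply: Or33]; apply/val_inj.
Qed.

(** Cubing fixes the coefficients, which come from GF(3), so it commutes with evaluation. *)
Lemma root_frobenius (F : finFieldType) (phi : {rmorphism 'F_3 -> F})
    (q : {poly 'F_3}) (a : F) (i : nat) :
  3%N \in [pchar F] ->
  root (map_poly phi q) a -> root (map_poly phi q) (a ^+ (3 ^ i)).
Proof.
move=> c3; elim: i => [|i IH] // /IH /rootP E; apply/rootP.
rewrite expnSr exprM.
have -> : map_poly phi q = map_poly (pFrobenius_aut c3) (map_poly phi q).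
  rewrite -map_poly_comp; apply: eq_map_poly => c /=.
  rewrite pFrobenius_autE -rmorphXn; congr (phi _).
  by have := expf_card c; rewrite card_Fp // => ->.
by rewrite -(pFrobenius_autE c3) horner_map E rmorph0.
Qed.

(** A nonzero remainder modulo p would vanish at a and be shorter than p. *)
Lemma minpoly3_dvd (F : finFieldType) (phi : {rmorphism 'F_3 -> F})
    (a : F) (p q : {poly 'F_3}) :
  F3toF F =1 phi -> is_minpoly3 a p ->
  (p %| q) = root (map_poly phi q) a.
Proof.
move=> ephi [mp rp minp]; have eqm := eq_map_poly ephi; rewrite eqm in rp.
apply/idP/idP => [/dvdpP[r ->]|rq]; first by rewrite rmorphM rootM rp orbT.
apply/negPn/negP; rewrite /dvdp => r0.
have rr : root (map_poly phi (q %% p)) a.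
  move: rq; rewrite {1}(divp_eq q p) rmorphD rmorphM /= /root hornerD hornerM.
  by rewrite (rootP rp) mulr0 add0r.
by have := minp _ r0; rewrite eqm => /(_ rr); rewrite leqNgt ltn_modp monic_neq0.
Qed.

Lemma wpolyE (n : nat) (c : 'rV['F_3]_n) : wpoly c = rVpoly c.
Proof.
rewrite /wpoly /rVpoly poly_def; apply: eq_bigr => i _.
by rewrite valK.
Qed.

Lemma horner_wpoly (F : finFieldType) (phi : {rmorphism 'F_3 -> F})
    (n : nat) (c : 'rV['F_3]_n) (a : F) :
  (map_poly phi (wpoly c)).[a] = \sum_(i < n) phi (c 0 i) * a ^+ i.
Proof.
rewrite /wpoly rmorph_sum horner_sum; apply: eq_bigr => i _.
by rewrite /= map_polyZ map_polyXn hornerZ hornerXn.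
Qed.

(** Pigeonhole: among the 3^(m+1) polynomials of size at most m + 1, two take the same value at a,
    and their difference vanishes there. *)
Lemma size_minpoly3_le (F : finFieldType) (phi : {rmorphism 'F_3 -> F})
    (m : nat) (a : F) (p : {poly 'F_3}) :
  #|F| = (3 ^ m)%N -> F3toF F =1 phi -> is_minpoly3 a p -> (size p <= m.+1)%N.
Proof.
move=> cF ephi mp; pose ev (c : 'rV['F_3]_m.+1) := (map_poly phi (wpoly c)).[a].
have : ~~ injectiveb ev.
  apply/negP => /injectiveP /leq_card.
  by rewrite card_mx card_Fp // mul1n cF leq_exp2l // ltnn.
case/injectivePn => c [d] cd Ecd.
have [_ _ minp] := mp.
apply: leq_trans (minp (wpoly (c - d)) _ _) _.
- rewrite wpolyE; apply: contraNneq cd => /(congr1 (@poly_rV _ m.+1)).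
  by rewrite rVpolyK linear0 => /eqP; rewrite subr_eq0.
- rewrite (eq_map_poly ephi) /root wpolyE raddfB /= -!wpolyE rmorphB /= hornerD hornerN.
  by rewrite subr_eq0; apply/eqP.
- by rewrite wpolyE size_poly.
Qed.

(** The m distinct conjugates of a are all roots of p. *)
Lemma size_minpoly3_ge (F : finFieldType) (phi : {rmorphism 'F_3 -> F})
    (m : nat) (a : F) (p : {poly 'F_3}) :
  3%N \in [pchar F] -> F3toF F =1 phi -> is_minpoly3 a p ->
  {in gtn m &, injective (fun i => a ^+ (3 ^ i))} -> (m < size p)%N.
Proof.
move=> c3 ephi [mp rp _] inj.
rewrite (eq_map_poly ephi) in rp.
have := @max_poly_roots _ (map_poly phi p) (mkseq (fun i => a ^+ (3 ^ i)) m).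
rewrite size_mkseq size_map_poly; apply.
- by rewrite map_poly_eq0 monic_neq0.
- by apply/allP => _ /mapP[i _ ->]; apply: root_frobenius.
- by apply/mkseq_uniqP.
Qed.

Lemma minpoly3_coprime (F : finFieldType) (phi : {rmorphism 'F_3 -> F})
    (a b : F) (p q : {poly 'F_3}) :
  F3toF F =1 phi -> is_minpoly3 a p -> is_minpoly3 b q ->
  ~~ root (map_poly phi p) b -> coprimep p q.
Proof.
move=> ephi mp mq nr; pose d := gcdp p q.
(* Irreducibility: if r = s d, then c is a root of s or of d, so r divides one of them; r dividing s
   would make d constant. Hence a nonconstant gcd is a multiple of both p and q, and b becomes a
   root of p. *)
have irr (c : F) (r : {poly 'F_3}) : is_minpoly3 c r -> d %| r -> size d != 1 -> r %| d.
  move=> mr dr sd; have [monr rr _] := mr.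
  have r0 := monic_neq0 monr.
  move: dr => /dvdpP[s Es].
  have [s0 d0] : s != 0 /\ d != 0.
    by move: r0; rewrite Es mulf_eq0 negb_or => /andP.
  have : (r %| s) || (r %| d).
    move: rr; rewrite (eq_map_poly ephi) {1}Es rmorphM rootM.
    by rewrite -!(minpoly3_dvd F phi c r _ ephi mr).
  case/orP => // /(dvdp_leq s0); rewrite {1}Es size_mul // => le.
  move: sd le (size_poly_eq0 d) (size_poly_eq0 s); rewrite (negbTE s0) (negbTE d0).
  by move: (size d) (size s) => x y; lia.
rewrite /coprimep -/d; apply/negPn/negP => nsz.
have pd := irr _ _ mp (dvdp_gcdl p q) nsz.
move: nr; rewrite -(minpoly3_dvd F phi b q _ ephi mq) => /negP; apply.
apply: dvdp_trans (irr _ _ mq (dvdp_gcdr p q) nsz) _.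
exact: dvdp_gcdl.
Qed.

Lemma card_cyclic_code (n : nat) (g : {poly 'F_3}) :
  g \is monic -> (size g <= n.+1)%N ->
  #|cyclic_code n g| = (3 ^ (n - (size g).-1))%N.
Proof.
move=> mg sg; have g0 := monic_neq0 mg.
have [d Ed] : exists d, size g = d.+1.
  by exists (size g).-1; rewrite prednK // size_poly_gt0.
move: sg; rewrite Ed ltnS /= => sg.
have [k kE] : exists k, k = (n - d)%N by exists (n - d)%N.
rewrite -kE.
(* The encoder: messages of length n - deg g, multiplied by g, run through the code exactly once. *)
pose enc (v : 'rV['F_3]_k) : 'rV['F_3]_n := poly_rV (rVpoly v * g).
have Kenc v : rVpoly (enc v) = rVpoly v * g.
  apply: poly_rV_K; apply: leq_trans (size_polyMleq _ _) _.
  have sv : (size (rVpoly v) <= k)%N by exact: size_poly.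
  by rewrite Ed; move: sv; move: (size (rVpoly v)) => x; lia.
have enc_inj : injective enc.
  move=> v w /(congr1 rVpoly); rewrite !Kenc => /(mulIf g0).
  exact: (can_inj rVpolyK).
rewrite -[in RHS](card_Fp (isT : prime 3)) -[k in RHS]mul1n -card_mx -(card_imset _ enc_inj).
apply: eq_card => c; rewrite inE wpolyE; apply/idP/imsetP => [/dvdpP[r Er]|[v _ ->]]; last first.
  by rewrite Kenc dvdp_mull.
have sr : (size r <= k)%N.
  case: (eqVneq r 0) => [->|r0]; first by rewrite size_poly0.
  have : (size (rVpoly c) <= n)%N by exact: size_poly.
  have : (0 < size r)%N by rewrite size_poly_gt0.
  by rewrite Er size_mul // Ed; move: (size r) => x; lia.
exists (poly_rV r) => //; apply: (can_inj rVpolyK).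
by rewrite Kenc poly_rV_K.
Qed.

(** * Syndromes, and the exclusion of weights at most 3 *)

(* The unit vector at the position i with alpha^i = x, and the zero word if
   x = 0; with this convention its syndrome at alpha^j is x^j also for x = 0. *)
Definition loc_word (F : finFieldType) (alpha : F) (n : nat) (x : F) : 'rV['F_3]_n :=
  \row_i (alpha ^+ i == x)%:R.

Definition syndrome (F : finFieldType) (phi : {rmorphism 'F_3 -> F}) (n : nat)
    (b : F) (c : 'rV['F_3]_n) : F :=
  \sum_(i < n) phi (c 0 i) * b ^+ i.

Lemma syndromeD (F : finFieldType) (phi : {rmorphism 'F_3 -> F}) (n : nat)
    (b : F) (c d : 'rV['F_3]_n) :
  syndrome F phi n b (c + d) = syndrome F phi n b c + syndrome F phi n b d.
Proof.
by rewrite -big_split /=; apply: eq_bigr => i _; rewrite mxE rmorphD mulrDl.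
Qed.

Lemma syndromeZ (F : finFieldType) (phi : {rmorphism 'F_3 -> F}) (n : nat)
    (b : F) (a : 'F_3) (c : 'rV['F_3]_n) :
  syndrome F phi n b (a *: c) = phi a * syndrome F phi n b c.
Proof.
by rewrite big_distrr /=; apply: eq_bigr => i _; rewrite mxE rmorphM mulrA.
Qed.

Lemma syndromeN (F : finFieldType) (phi : {rmorphism 'F_3 -> F}) (n : nat)
    (b : F) (c : 'rV['F_3]_n) :
  syndrome F phi n b (- c) = - syndrome F phi n b c.
Proof. by rewrite -scaleN1r syndromeZ rmorphN1 mulN1r. Qed.

Lemma syndrome_loc_word (F : finFieldType) (phi : {rmorphism 'F_3 -> F}) (n j : nat)
    (alpha x : F) :
  #|F| = n.+1 -> n.-primitive_root alpha -> (0 < j)%N ->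
  syndrome F phi n (alpha ^+ j) (loc_word F alpha n x) = x ^+ j.
Proof.
move=> cF pa j0; case: (eqVneq x 0) => [->|x0].
  rewrite expr0n -(prednK j0) /= /syndrome big1 // => i _.
  by rewrite mxE expf_eq0 (prim_root_eq0 pa) (gtn_eqF (prim_order_gt0 pa)) andbF rmorph0 mul0r.
have xn : x ^+ n = 1 by apply: (mulfI x0); rewrite -exprS -cF expf_card mulr1.
have [i ->] := prim_rootP pa xn.
rewrite /syndrome (bigD1 i) //= mxE eqxx rmorph1 mul1r big1 ?addr0 => [|k ki].
  by rewrite -!exprM mulnC.
rewrite mxE (eq_prim_root_expr pa) !modn_small //.
by rewrite (inj_eq val_inj) (negbTE ki) rmorph0 mul0r.
Qed.

Lemma wtD (n : nat) (c d : 'rV['F_3]_n) : (wt (c + d) <= wt c + wt d)%N.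
Proof.
rewrite /wt; apply: leq_trans (leq_card_setU _ _); apply: subset_leq_card.
apply/subsetP => i; rewrite !inE mxE; apply: contraR.
by rewrite negb_or !negbK => /andP[/eqP -> /eqP ->]; rewrite addr0.
Qed.

Lemma wtZ (n : nat) (a : 'F_3) (c : 'rV['F_3]_n) : (wt (a *: c) <= wt c)%N.
Proof.
apply: subset_leq_card; apply/subsetP => i; rewrite !inE mxE.
by apply: contraNneq => ->; rewrite mulr0.
Qed.

Lemma wtN (n : nat) (c : 'rV['F_3]_n) : (wt (- c) <= wt c)%N.
Proof. by rewrite -scaleN1r wtZ. Qed.

Lemma wt_loc_word (F : finFieldType) (n : nat) (alpha x : F) :
  n.-primitive_root alpha -> (wt (loc_word F alpha n x) <= 1)%N.
Proof.
move=> pa; apply/card_le1_eqP => i j; rewrite !inE !mxE.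
case: (eqVneq (alpha ^+ i) x) => // <- _.
rewrite (eq_prim_root_expr pa) !modn_small //.
by case: (eqVneq (val j) (val i)) => // /ord_inj ->.
Qed.

(** All coefficients are 1 or -1. If they agree, the points form an arithmetic progression, as do
    their images; otherwise one point is the sum of the other two, and likewise for the images. *)
Lemma planar_signed_triple (F : finFieldType) (f : F -> F) (phi : {rmorphism 'F_3 -> F})
    (a b c : 'F_3) (x y z : F) :
  3%:R = 0 :> F -> planar f -> f 0 = 0 ->
  a != 0 -> b != 0 -> c != 0 -> x != 0 -> y != 0 -> z != 0 -> x != z ->
  phi a * x + phi b * y + phi c * z = 0 ->
  phi a * f x + phi b * f y + phi c * f z <> 0.
Proof.
move=> c3 pf f0 a0 b0 c0 x0 y0 z0 xz.
have same : x + y + z = 0 -> f x + f y + f z = 0 -> False.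
  by move=> E1 E2; move/eqP: xz; apply; apply: (planar_zero_sum_triple F f x y z).
have diff u v w : u != 0 -> v != 0 -> u + v = w -> f u + f v = f w -> False.
  move=> /eqP u0 /eqP v0 <- E; have := planar_additive_pair F f u v pf f0.
  by case.
case: (F3_cases a) a0 => -> // _; case: (F3_cases b) b0 => -> // _;
case: (F3_cases c) c0 => -> // _; rewrite ?rmorphN1 ?rmorph1 ?mulN1r ?mul1r => E1 E2.
- exact: same.
- apply: (diff x y z) => //; apply: subr0_eq; [exact: E1 | exact: E2].
- by apply: (diff x z y) => //; apply: subr0_eq; [rewrite -E1 | rewrite -E2]; ring.
- by apply: (diff y z x) => //; apply: subr0_eq; rewrite -oppr0; [rewrite -E1 | rewrite -E2]; ring.
- by apply: (diff y z x) => //; apply: subr0_eq; [rewrite -E1 | rewrite -E2]; ring.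
- by apply: (diff x z y) => //; apply: subr0_eq; rewrite -oppr0; [rewrite -E1 | rewrite -E2]; ring.
- by apply: (diff x y z) => //; apply: subr0_eq; rewrite -oppr0; [rewrite -E1 | rewrite -E2]; ring.
- by apply: same; rewrite -[RHS]oppr0; [rewrite -E1 | rewrite -E2]; ring.
Qed.

(** Opposite signs force x = y; equal signs force y = -x, and evenness of e then makes the second
    sum equal to 2 x^e up to sign. *)
Lemma signed_pair (F : finFieldType) (e : nat) (phi : {rmorphism 'F_3 -> F})
    (a b : 'F_3) (x y : F) :
  2%:R != 0 :> F -> ~~ odd e ->
  a != 0 -> b != 0 -> x != 0 -> x != y ->
  phi a * x + phi b * y = 0 -> phi a * x ^+ e + phi b * y ^+ e <> 0.
Proof.
move=> two0 ee a0 b0 x0 /eqP xy.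
have Ne z := exprN_even F z e ee.
have xe : x ^+ e + x ^+ e <> 0.
  by apply/eqP; rewrite -mulr2n -mulr_natl mulf_neq0 ?expf_neq0.
case: (F3_cases a) a0 => -> // _; case: (F3_cases b) b0 => -> // _;
rewrite ?rmorphN1 ?rmorph1 ?mulN1r ?mul1r => E1 E2.
- move/eqP: E1; rewrite addr_eq0 => /eqP E1.
  by apply: xe; move: E2; rewrite E1 Ne.
- by apply: xy; apply: subr0_eq.
- by apply: xy; apply: subr0_eq; rewrite -oppr0 -E1; ring.
- move/eqP: E1; rewrite -opprD oppr_eq0 addr_eq0 => /eqP E1.
  by move/eqP: E2; rewrite -opprD oppr_eq0 E1 Ne => /eqP E2; apply: xe; rewrite E1 Ne.
Qed.

Lemma planar_low_weight (F : finFieldType) (phi : {rmorphism 'F_3 -> F}) (n e : nat)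
    (alpha : F) (c : 'rV['F_3]_n) :
  3%:R = 0 :> F -> n.-primitive_root alpha ->
  planar (fun x : F => x ^+ e) -> ~~ odd e -> (0 < e)%N ->
  syndrome F phi n alpha c = 0 -> syndrome F phi n (alpha ^+ e) c = 0 ->
  (wt c <= 3)%N -> c = 0.
Proof.
move=> c3 pa pf ee e0 S1 S2.
have two0 : 2%:R != 0 :> F.
  by apply/eqP => two; move/eqP: c3; rewrite mulrS two addr0 oner_eq0.
have supp b : syndrome F phi n b c =
    \sum_(i <- enum [set i | c 0 i != 0]) phi (c 0 i) * b ^+ i.
  rewrite big_enum /= /syndrome (bigID (fun i => c 0 i == 0)) /= big1 ?add0r.
    by apply: eq_bigl => i; rewrite inE.
  by move=> i /eqP ->; rewrite rmorph0 mul0r.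
rewrite !supp in S1 S2; rewrite /wt cardE.
have nz i : i \in enum [set i | c 0 i != 0] -> c 0 i != 0 by rewrite mem_enum inE.
have xn0 (i : 'I_n) : alpha ^+ i != 0.
  by rewrite expf_neq0 // (prim_root_eq0 pa) -lt0n (prim_order_gt0 pa).
have xinj (i j : 'I_n) : i != j -> alpha ^+ i != alpha ^+ j.
  by rewrite (eq_prim_root_expr pa) !modn_small.
have := enum_uniq [set i | c 0 i != 0].
(* Case analysis on the support of c, which has at most three positions. *)
case Es: (enum _) S1 S2 nz => [|i [|j [|k [|//]]]]; rewrite ?big_cons !big_nil ?addr0.
- move=> _ _ _ _ _; apply/rowP => i; rewrite mxE; apply/eqP/negPn/negP => ci.
  by have := mem_enum [set i | c 0 i != 0] i; rewrite Es !inE ci.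
- move=> /eqP S1 _ nz; move: S1; rewrite mulf_eq0 (negbTE (xn0 i)) orbF fmorph_eq0.
  by rewrite (negbTE (nz i _)) ?inE.
- rewrite !(exprAC alpha e) => S1 S2 nz; rewrite /= inE andbT => ij _; exfalso.
  have [ci cj] : c 0 i != 0 /\ c 0 j != 0 by split; apply: nz; rewrite !inE eqxx ?orbT.
  exact: (signed_pair F e phi _ _ _ _ two0 ee ci cj (xn0 i) (xinj _ _ ij) S1 S2).
- rewrite !(exprAC alpha e) !addrA => S1 S2 nz.
  rewrite /= !inE negb_or => /and3P[/andP[ij ik] jk _] _; exfalso.
  have f0 : (0 : F) ^+ e = 0 by rewrite expr0n (gtn_eqF e0).
  have [ci cj ck] : [/\ c 0 i != 0, c 0 j != 0 & c 0 k != 0].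
    by split; apply: nz; rewrite !inE eqxx ?orbT.
  exact: (planar_signed_triple F _ phi _ _ _ _ _ _ c3 pf f0 ci cj ck
    (xn0 i) (xn0 j) (xn0 k) (xinj _ _ ik) S1 S2).
Qed.

(** * Code membership by syndromes, and explicit words of small weight *)

Lemma mem_cyclic_code (F : finFieldType) (phi : {rmorphism 'F_3 -> F}) (n : nat)
    (a b : F) (p q : {poly 'F_3}) (c : 'rV['F_3]_n) :
  F3toF F =1 phi -> is_minpoly3 a p -> is_minpoly3 b q -> coprimep p q ->
  (c \in cyclic_code n (p * q)) =
  (syndrome F phi n a c == 0) && (syndrome F phi n b c == 0).
Proof.
move=> ephi mp mq cop; rewrite inE Gauss_dvdp //.
by rewrite (minpoly3_dvd F phi a) // (minpoly3_dvd F phi b) // /root !horner_wpoly.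
Qed.

(** The injective increment map [D] on a finite field is onto, which yields x. The points x and x +
    a may be 0 or meet 1 or alpha, so the weight is only bounded above. *)
Lemma planar_weight4_word (F : finFieldType) (phi : {rmorphism 'F_3 -> F}) (n e : nat)
    (alpha : F) :
  #|F| = n.+1 -> n.-primitive_root alpha -> (2 < n)%N -> (0 < e)%N ->
  planar (fun x : F => x ^+ e) ->
  exists c : 'rV['F_3]_n, [/\ c != 0, (wt c <= 4)%N,
    syndrome F phi n alpha c = 0 & syndrome F phi n (alpha ^+ e) c = 0].
Proof.
move=> cF pa n2 e0 /planarP inj; pose a := 1 + alpha.
have n0 := prim_order_gt0 pa.
have alpha1 : alpha != 1.
  by rewrite -[alpha]expr1 -(expr0 alpha) (eq_prim_root_expr pa) !modn_small // ltnW.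
have a0 : a != 0.
  apply/eqP => a0; have : alpha ^+ 2 == alpha ^+ 0.
    by rewrite expr0 sqrf_eq1 -(addr_eq0 alpha 1) [alpha + 1]addrC -/a a0 eqxx orbT.
  by rewrite (eq_prim_root_expr pa) !modn_small.
pose D (x : F) := (x + a) ^+ e - x ^+ e.
have injD : injective D by move=> x y; apply: (inj a).
have [x Dx] : exists x, D x = 1 + alpha ^+ e.
  by exists (invF injD (1 + alpha ^+ e)); rewrite f_invF.
pose d := loc_word F alpha n.
exists (d (x + a) - d x - d 1 - d alpha).
have Sd j : (0 < j)%N -> syndrome F phi n (alpha ^+ j) (d (x + a) - d x - d 1 - d alpha) =
   (x + a) ^+ j - x ^+ j - 1 - alpha ^+ j.
  by move=> j0; rewrite !syndromeD !syndromeN !syndrome_loc_word // expr1n.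
split.
- apply/eqP => /rowP E.
  (* A zero word would have zero entries at the positions of 1 and alpha; modulo 3 this forces x + a
     to equal both. *)
  have bit (u v b : bool) : u%:R - v%:R - b%:R - (~~ b)%:R = 0 :> 'F_3 -> u.
    by case: u; case: v; case: b.
  have := E (Ordinal n0); have := E (Ordinal (ltnW n2)).
  rewrite !mxE /= expr0 expr1 !eqxx (eq_sym 1 alpha) (negbTE alpha1).
  move=> /(bit _ _ false) /eqP E1 /(bit _ _ true) /eqP E2.
  by move/eqP: alpha1; apply; rewrite E1 E2.
- have w y := wt_loc_word F n alpha y pa.
  have wN y := leq_trans (wtN n (d y)) (w y).
  have w2 := leq_trans (wtD n _ _) (leq_add (w (x + a)) (wN x)).
  have w3 := leq_trans (wtD n _ _) (leq_add w2 (wN 1)).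
  exact: leq_trans (wtD n _ _) (leq_add w3 (wN alpha)).
- by rewrite -[alpha in LHS]expr1 Sd // /a !expr1; ring.
- by rewrite Sd // -/(D x) Dx; ring.
Qed.

Lemma odd_power_weight2_word (F : finFieldType) (phi : {rmorphism 'F_3 -> F}) (n e : nat)
    (alpha : F) :
  #|F| = n.+1 -> n.-primitive_root alpha -> 2%:R != 0 :> F -> odd e ->
  exists c : 'rV['F_3]_n, [/\ c != 0, (wt c <= 2)%N,
    syndrome F phi n alpha c = 0 & syndrome F phi n (alpha ^+ e) c = 0].
Proof.
move=> cF pa two0 oe; have n0 := prim_order_gt0 pa.
pose d := loc_word F alpha n; exists (d 1 + d (-1)).
have Sd j : (0 < j)%N -> syndrome F phi n (alpha ^+ j) (d 1 + d (-1)) = 1 + (-1) ^+ j.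
  by move=> j0; rewrite !syndromeD !syndrome_loc_word // expr1n.
split.
- apply/eqP => /rowP /(_ (Ordinal n0)).
  rewrite !mxE /= expr0 eqxx -[_ == -1]subr_eq0 opprK -mulr2n (negbTE two0) addr0.
  by move/eqP; rewrite oner_eq0.
- apply: leq_trans (wtD _ _ _) _.
  by rewrite (leq_add (wt_loc_word F n alpha _ pa) (wt_loc_word F n alpha _ pa)).
- by rewrite -[alpha in LHS]expr1 Sd // expr1 subrr.
- by rewrite Sd ?odd_gt0 // -signr_odd oe expr1 subrr.
Qed.

(* On the fixed field of x -> x^(3^h) the map x -> x^e is x -> +-x, and by
   evenness of e it fixes its values: so any linear relation between three
   such elements becomes a codeword after replacing each of them by +-itself. *)
Lemma subfield_weight3_word (F : finFieldType) (phi : {rmorphism 'F_3 -> F}) (n h : nat)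
    (alpha u : F) :
  #|F| = n.+1 -> n.-primitive_root alpha -> 3%N \in [pchar F] -> odd h ->
  u ^+ (3 ^ h) = u -> u ^+ 2 != 1 -> u != 0 ->
  let e := ((3 ^ h + 1) %/ 2)%N in
  exists c : 'rV['F_3]_n, [/\ c != 0, (wt c <= 3)%N,
    syndrome F phi n alpha c = 0 & syndrome F phi n (alpha ^+ e) c = 0].
Proof.
move=> cF pa c3 oh uh u1 u0 e; have n0 := prim_order_gt0 pa.
have e0 : (0 < e)%N by rewrite -double_gt0 half_expn3 addn1.
have ee : ~~ odd e by rewrite odd_half_expn3 oh.
have Ne z := exprN_even F z e ee.
(* From v^(2e) = v^(3^h + 1) = v^2 comes v^e = v or v^e = -v, and the even power e absorbs the sign
   the second time. *)
have sgn (v : F) : v ^+ (3 ^ h) = v ->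
    exists s : 'F_3, v ^+ e = phi s * v /\ (v ^+ e) ^+ e = phi s * v /\ phi s * (phi s * v) = v.
  move=> vh; have : (v ^+ e) ^+ 2 == v ^+ 2.
    by rewrite -exprM muln2 half_expn3 addn1 exprSr vh.
  rewrite eqf_sqr => /orP[] /eqP E.
    by exists 1; rewrite rmorph1 !mul1r !E.
  by exists (-1); rewrite rmorphN1 !mulN1r E Ne E opprK.
have [s [s1 [s2 s3]]] := sgn u uh.
have [t [t1 [t2 t3]]] : exists t : 'F_3, (u + 1) ^+ e = phi t * (u + 1) /\
   ((u + 1) ^+ e) ^+ e = phi t * (u + 1) /\ phi t * (phi t * (u + 1)) = u + 1.
  by apply: sgn; rewrite exprD_pow3 // uh expr1n.
pose d := loc_word F alpha n.
(* The signs s and t undo those of the locators, so both syndromes reduce to u + 1 - (u + 1). *)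
pose c := s *: d (u ^+ e) + d 1 + (- t) *: d ((u + 1) ^+ e).
have Sd j : (0 < j)%N -> syndrome F phi n (alpha ^+ j) c =
    phi s * (u ^+ e) ^+ j + 1 - phi t * ((u + 1) ^+ e) ^+ j.
  move=> j0; rewrite !syndromeD !syndromeZ !syndrome_loc_word // expr1n.
  by rewrite rmorphN mulNr.
have no1 v : v ^+ (3 ^ h) = v -> v ^+ 2 != 1 -> (1 == v ^+ e) = false.
  move=> vh; apply: contraNF => /eqP v1; rewrite -[v ^+ 2]/(v * v) -{1}vh -exprSr.
  by rewrite -addn1 -half_expn3 -muln2 exprM -/e -v1 expr1n.
exists c; split.
- apply/eqP => /rowP /(_ (Ordinal n0)).
  rewrite !mxE /= expr0 eqxx no1 // no1.
  + by rewrite !mulr0 add0r addr0 => /eqP; rewrite oner_eq0.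
  + by rewrite exprD_pow3 // uh expr1n.
  (* In characteristic 3, (u + 1)^2 = 1 only for u = 0 or u = 1; so the entry at position 0 stays
     1. *)
  rewrite -subr_eq0; have -> : (u + 1) ^+ 2 - 1 = u * (u - 1) + 3%:R * u by ring.
  rewrite (natr3_pchar _ c3) mul0r addr0 mulf_neq0 // subr_eq0.
  by apply: contraNneq u1 => ->; rewrite expr1n.
- have w y := wt_loc_word F n alpha y pa.
  have wZ r y := leq_trans (wtZ n r (d y)) (w y).
  have w2 := leq_trans (wtD n _ _) (leq_add (wZ s (u ^+ e)) (w 1)).
  exact: leq_trans (wtD n _ _) (leq_add w2 (wZ (- t) ((u + 1) ^+ e))).
- by rewrite -[alpha in LHS]expr1 Sd // !expr1 s1 t1 s3 t3 subrr.
- by rewrite Sd // s2 t2 s3 t3 subrr.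
Qed.

(** For g = gcd(m, h), the number 3^g - 1 divides both 3^m - 1 and 3^h - 1. The witness alpha^r with
    r = (3^m - 1)/(3^g - 1) has order 3^g - 1, which is at least 8. *)
Lemma subfield_element (F : finFieldType) (alpha : F) (m h : nat) :
  (0 < m)%N -> (3 ^ m - 1)%N.-primitive_root alpha -> (1 < gcdn m h)%N ->
  exists u : F, [/\ u ^+ (3 ^ h) = u, u ^+ 2 != 1 & u != 0].
Proof.
move=> m0 pa g1; set g := gcdn m h in g1.
have dvdg k : (g %| k)%N -> (3 ^ g - 1 %| 3 ^ k - 1)%N.
  by move=> /dvdnP[r ->]; rewrite mulnC expnM !subn1 dvdn_pred_predX.
have [r Er] := dvdnP (dvdg m (dvdn_gcdl m h)).
have [s Es] := dvdnP (dvdg h (dvdn_gcdr m h)).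
have g9 : (3 ^ 2 <= 3 ^ g)%N by rewrite leq_exp2l.
have n0 := prim_order_gt0 pa.
have u0 : alpha ^+ r != 0.
  by rewrite expf_neq0 // (prim_root_eq0 pa) -lt0n.
exists (alpha ^+ r); split=> //.
- have -> : (3 ^ h = (s * (3 ^ g - 1)).+1)%N by rewrite -Es subn1 prednK ?expn_gt0.
  rewrite exprS mulnC exprM -[(alpha ^+ r) ^+ (_ - _)]exprM -Er (prim_expr_order pa).
  by rewrite expr1n mulr1.
- rewrite -exprM -(expr0 alpha) (eq_prim_root_expr pa) mod0n.
  have r0 : (0 < r)%N by move: n0; rewrite Er; case: r {Er u0}.
  rewrite modn_small; first by rewrite muln_eq0 negb_or -lt0n r0.
  by rewrite Er ltn_pmul2l // ltn_subRL; apply: leq_trans g9.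
Qed.

(** * Degrees and coprimality of the two minimal polynomials *)

Lemma double_expn3_lt (m i : nat) : (2 <= m)%N -> (i < m)%N -> (2 * 3 ^ i < 3 ^ m - 1)%N.
Proof.
move=> m2 im.
have h3 : (3 ^ i <= 3 ^ m.-1)%N by rewrite leq_exp2l //; lia.
have m9 : (3 ^ 1 <= 3 ^ m.-1)%N by rewrite leq_exp2l //; lia.
have -> : (3 ^ m = 3 * 3 ^ m.-1)%N by rewrite -expnS prednK //; lia.
by lia.
Qed.

Lemma double_le_expn3 (m : nat) : (2 <= m)%N -> (2 * m <= 3 ^ m - 1)%N.
Proof.
case: m => [|[|m]] // _; elim: m => // m; rewrite [(3 ^ m.+3)%N]expnS; lia.
Qed.

(** The exponents stay below the order of alpha, so no reduction occurs. The case k = 2 serves to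
    compare conjugates up to sign. *)
Lemma scaled_expn3_prim_inj (F : finFieldType) (alpha : F) (m k i j : nat) :
  (2 <= m)%N -> (3 ^ m - 1)%N.-primitive_root alpha -> (0 < k <= 2)%N ->
  (i < m)%N -> (j < m)%N -> alpha ^+ (k * 3 ^ i) = alpha ^+ (k * 3 ^ j) -> i = j.
Proof.
move=> m2 pa /andP[k0 k2] im jm /eqP.
have lt l : (l < m)%N -> (k * 3 ^ l < 3 ^ m - 1)%N.
  by move=> lm; apply: leq_ltn_trans (double_expn3_lt m l m2 lm); rewrite leq_mul2r k2 orbT.
rewrite (eq_prim_root_expr pa) !modn_small ?lt // eqn_pmul2l //.
by move/eqP/(expnI (isT : 1 < 3)%N).
Qed.

Lemma size_minpoly3_primitive (F : finFieldType) (alpha : F) (m : nat) (p : {poly 'F_3}) :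
  #|F| = (3 ^ m)%N -> (2 <= m)%N -> (3 ^ m - 1)%N.-primitive_root alpha ->
  is_minpoly3 alpha p -> size p = m.+1.
Proof.
move=> cF m2 pa mp; have c3 := card_finPcharP cF isT.
have [phi ephi] := pchar3_F3toF F c3.
apply/eqP; rewrite eqn_leq (size_minpoly3_le F phi m alpha) //.
apply: (size_minpoly3_ge F phi m alpha) => // i j im jm E.
by apply: (scaled_expn3_prim_inj F alpha m 1) => //; rewrite !mul1n.
Qed.

(** By planarity, equal conjugates of alpha^e come from conjugates of alpha equal up to sign;
    squaring removes the sign. *)
Lemma size_minpoly3_planar (F : finFieldType) (alpha : F) (m e : nat) (p : {poly 'F_3}) :
  #|F| = (3 ^ m)%N -> (2 <= m)%N -> (3 ^ m - 1)%N.-primitive_root alpha ->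
  planar (fun x : F => x ^+ e) -> ~~ odd e ->
  is_minpoly3 (alpha ^+ e) p -> size p = m.+1.
Proof.
move=> cF m2 pa pf ee mp; have c3 := card_finPcharP cF isT.
have [phi ephi] := pchar3_F3toF F c3.
apply/eqP; rewrite eqn_leq (size_minpoly3_le F phi m (alpha ^+ e)) //.
apply: (size_minpoly3_ge F phi m (alpha ^+ e)) => // i j im jm.
rewrite !(exprAC alpha e) => E.
apply: (scaled_expn3_prim_inj F alpha m 2) => //.
rewrite mulnC exprM [(2 * _)%N]mulnC [RHS]exprM.
by case: (planar_power_eq F e _ _ pf ee E) => ->; rewrite ?sqrrN.
Qed.

(** The m conjugates of alpha already exhaust the roots of p, and alpha^e is not among them. *)
Lemma minpoly3_primitive_coprime (F : finFieldType) (alpha : F) (m e : nat)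
    (p q : {poly 'F_3}) :
  #|F| = (3 ^ m)%N -> (2 <= m)%N -> (3 ^ m - 1)%N.-primitive_root alpha ->
  (e < 3 ^ m - 1)%N -> (forall i, e != 3 ^ i)%N ->
  is_minpoly3 alpha p -> is_minpoly3 (alpha ^+ e) q -> coprimep p q.
Proof.
move=> cF m2 pa en ne mp mq; have c3 := card_finPcharP cF isT.
have [phi ephi] := pchar3_F3toF F c3.
apply: (minpoly3_coprime F phi alpha (alpha ^+ e)) => //; apply/negP => re.
have [monp rp _] := mp; rewrite (eq_map_poly ephi) in rp.
pose s := mkseq (fun i => alpha ^+ (3 ^ i)) m.
have us : uniq s.
  apply/mkseq_uniqP => i j im jm E.
  by apply: (scaled_expn3_prim_inj F alpha m 1) => //; rewrite !mul1n.
have rs : all (root (map_poly phi p)) s.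
  by apply/allP => _ /mapP[i _ ->]; apply: root_frobenius.
have nes : alpha ^+ e \notin s.
  apply/negP => /mapP[i]; rewrite mem_iota /= => im /eqP.
  have lt : (3 ^ i < 3 ^ m - 1)%N by have := double_expn3_lt m i m2 im; lia.
  by rewrite (eq_prim_root_expr pa) !modn_small // (negbTE (ne i)).
have p0 : map_poly phi p != 0 by rewrite map_poly_eq0 monic_neq0.
have := @max_poly_roots _ _ (alpha ^+ e :: s) p0.
rewrite /= re rs nes us size_map_poly (size_minpoly3_primitive F alpha m p) //.
by rewrite size_mkseq ltnn => /(_ isT isT).
Qed.

(** This puts e outside the cyclotomic coset of 1: 3^h + 1 = 2 * 3^i fails modulo 3 unless i = 0,
    and then 3^h = 1. *)
Lemma half_expn3_neq (h i : nat) : (0 < h)%N -> ((3 ^ h + 1) %/ 2 != 3 ^ i)%N.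
Proof.
case: h => // h _; apply/eqP => E; have := half_expn3 h.+1; rewrite E expnS.
have := expn_gt0 3 h; case: i {E} => [|i] /=; rewrite ?expnS; lia.
Qed.

(* GF(3^m) is any finite field F with #|F| = 3^m; alpha generates F^*
   (a primitive (3^m-1)-th root of unity); p1, pe are the minimal polynomials
   over GF(3) of alpha and alpha^e; C_(1,e) is the cyclic code of length
   3^m - 1 with generator polynomial p1 * pe. *)
Theorem theorem3 (m h : nat) (F : finFieldType) (alpha : F)
    (p1 pe : {poly 'F_3}) :
  (2 <= m)%N -> (1 <= h)%N -> (h <= m - 1)%N ->
  #|F| = (3 ^ m)%N ->
  (3 ^ m - 1)%N.-primitive_root alpha ->
  let e := ((3 ^ h + 1) %/ 2)%N in
  is_minpoly3 alpha p1 -> is_minpoly3 (alpha ^+ e) pe ->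
  (has_dim_dist (cyclic_code (3 ^ m - 1) (p1 * pe)) (3 ^ m - 1 - 2 * m) 4
     <-> odd h /\ gcdn m h = 1%N) /\
  (odd h /\ gcdn m h = 1%N <-> planar (fun x : F => x ^+ e)).
Proof.
move=> m2 h1 hm cF pa e mp1 mpe.
have c3 := card_finPcharP cF isT; have c30 := natr3_pchar _ c3.
have [phi ephi] := pchar3_F3toF F c3.
have two0 : 2%:R != 0 :> F.
  by apply/eqP => two; move/eqP: c30; rewrite mulrS two addr0 oner_eq0.
have He := half_expn3 h; rewrite -/e in He.
have e0 : (0 < e)%N by rewrite -double_gt0 He addn1.
have oe : odd e = ~~ odd h by exact: odd_half_expn3.
have hm' : (h < m)%N by lia.
have en : (e < 3 ^ m - 1)%N by have := double_expn3_lt m h m2 hm'; have := expn_gt0 3 h; lia.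
have cFn : #|F| = (3 ^ m - 1).+1 by rewrite cF subn1 prednK // expn_gt0.
have cop : coprimep p1 pe.
  apply: (minpoly3_primitive_coprime F alpha m e) => // i.
  exact: half_expn3_neq.
have mem c := mem_cyclic_code F phi (3 ^ m - 1) _ _ _ _ c ephi mp1 mpe cop.
have code_to_cond : has_dim_dist (cyclic_code (3 ^ m - 1) (p1 * pe)) (3 ^ m - 1 - 2 * m) 4 ->
    odd h /\ gcdn m h = 1%N.
  case=> _ _ dmin.
  have light c : c != 0 -> (wt c <= 3)%N -> syndrome F phi (3 ^ m - 1) alpha c = 0 ->
      syndrome F phi (3 ^ m - 1) (alpha ^+ e) c = 0 -> False.
    move=> c0 wc S1 S2; have := dmin c; rewrite mem S1 S2 eqxx => /(_ isT c0).
    by rewrite leqNgt ltnS wc.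
  have oh : odd h.
    apply/negPn/negP => nh.
    have [] := odd_power_weight2_word F phi _ e alpha cFn pa two0; first by rewrite oe.
    by move=> c [c0 wc S1 S2]; apply: (light c) => //; apply: leq_trans wc _.
  split=> //; apply/eqP/negPn/negP => g1.
  have [|u [uh u1 u0]] := subfield_element F alpha m h (ltnW m2) pa.
    by rewrite ltn_neqAle eq_sym g1 gcdn_gt0 (ltnW m2).
  have [c [c0 wc S1 S2]] := subfield_weight3_word F phi _ h alpha u cFn pa c3 oh uh u1 u0.
  exact: (light c).
have cond_to_planar : odd h /\ gcdn m h = 1%N -> planar (fun x : F => x ^+ e).
  by case=> oh /eqP g1; apply: (half_power_planar F m h).
have planar_to_code : planar (fun x : F => x ^+ e) ->
    has_dim_dist (cyclic_code (3 ^ m - 1) (p1 * pe)) (3 ^ m - 1 - 2 * m) 4.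
  move=> pf; have ee := planar_power_even F e two0 pf.
  have s1 := size_minpoly3_primitive F alpha m p1 cF m2 pa mp1.
  have se := size_minpoly3_planar F alpha m e pe cF m2 pa pf ee mpe.
  have [mon1 _ _] := mp1; have [mone _ _] := mpe.
  have sg : size (p1 * pe) = (2 * m).+1.
    by rewrite size_mul ?monic_neq0 // s1 se; lia.
  have dmin c : c \in cyclic_code (3 ^ m - 1) (p1 * pe) -> c != 0 -> (4 <= wt c)%N.
    rewrite mem => /andP[/eqP S1 /eqP S2]; rewrite ltnNge; apply: contra => wc.
    by apply/eqP; apply: (planar_low_weight F phi _ e alpha c c30 pa pf ee e0).
  split=> //.
    by rewrite card_cyclic_code ?monicMl // sg // ltnS double_le_expn3.
  (* The bound [dmin] turns weight at most 4 into weight exactly 4. *)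
  have [|c [c0 wc S1 S2]] := planar_weight4_word F phi _ e alpha cFn pa _ e0 pf.
    by have := double_le_expn3 m m2; lia.
  have cC : c \in cyclic_code (3 ^ m - 1) (p1 * pe) by rewrite mem S1 S2 eqxx.
  by exists c => //; rewrite c0 eqn_leq wc dmin.
(* The three implications form a cycle, which gives both equivalences. *)
split; first by split=> [/code_to_cond | /cond_to_planar/planar_to_code].
by split=> [/cond_to_planar | /planar_to_code/code_to_cond].
Qed.
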